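(* Let $k\ge 1$, $\lambda>0$ and $\alpha,q\in(0,1)$. Then there exists $\varepsilon=\varepsilon(k,\lambda,\alpha,q)>0$ such that if $G=(V,E)$ is a Cayley graph of a finite Abelian group, with $|V|\ge 2$, all of whose degrees are at most $k$, and \[ \operatorname{diam}(G)\le\frac{\lambda|V|}{\log|V|}, \] then $p_c(G,\alpha,q)\le 1-\varepsilon$.
   Context: For a group $\Gamma$ with finite generating set $S$, the Cayley graph $\operatorname{Cay}(\Gamma,S)$ has vertex set $\Gamma$ and an edge $\{x,y\}$ whenever $x=ys$ for some $s\in S\cup S^{-1}\setminus\{\mathrm{id}\}$. Bernoulli-$p$ bond percolation keeps each edge independently with probability $p$; $\mathbb P_p$ denotes its law and clusters are connected components of the open subgraph. For a finite graph $G=(V,E)$ and $\alpha,q\in(0,1)$, \[ p_c(G,\alpha,q)=\inf\bigl\{p\in[0,1]:\mathbb P_p(\text{there is an open cluster }K\text{ with }|K|\ge\alpha|V|)\ge q\bigr\}. \] *)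

(* Defs.v *)
From HB Require Import structures.
From mathcomp Require Import all_boot all_order all_algebra all_fingroup.
From mathcomp Require Import all_classical all_reals all_analysis.
Set Implicit Arguments. Unset Strict Implicit. Unset Printing Implicit Defensive.
Import Order.TTheory GRing.Theory Num.Theory.

Section Cayley.
Variable gT : finGroupType.

Definition cay_gens (S : {set gT}) : {set gT} := ((S :|: S^-1) :\ 1)%g.

Definition cay_rel (S : {set gT}) : rel gT :=
  fun x y => ((y^-1 * x)%g \in cay_gens S).

Definition cay_deg (S : {set gT}) (x : gT) : nat := #|[set y | cay_rel S x y]|.
End Cayley.

Section Dist.
Variable T : finType.
Variable e : rel T.

Fixpoint gball (x : T) (n : nat) : {set T} :=
  if n is m.+1 then gball x m :|: [set y | [exists z in gball x m, e z y]]
  else [set x].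

(* graph distance (equals #|T| if y is unreachable from x) *)
Definition gdist (x y : T) : nat := find (fun n => y \in gball x n) (iota 0 #|T|).

Definition gdiam : nat := \max_(x : T) \max_(y : T) gdist x y.
End Dist.

Local Open Scope ring_scope.
Section Percolation.
Variable R : realType.
Variable T : finType.
Variable e : rel T.

Definition gedges : {set {set T}} := [set [set x; y] | x in T, y in [pred y | e x y]].

(* open subgraph for configuration w (w = set of open edges) *)
Definition open_rel (w : {set {set T}}) : rel T :=
  fun x y => e x y && ([set x; y] \in w).

Definition cluster (w : {set {set T}}) (x : T) : {set T} :=
  [set y | connect (open_rel w) x y].

Definition perc_prob (p : R) (A : pred {set {set T}}) : R :=
  \sum_(w in powerset gedges | A w) p ^+ #|w| * (1 - p) ^+ (#|gedges| - #|w|).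

Definition big_cluster (alpha : R) : pred {set {set T}} :=
  fun w => [exists x, alpha * #|T|%:R <= #|cluster w x|%:R].

Definition p_c (alpha q : R) : R :=
  inf [set p : R | 0 <= p <= 1 /\ q <= perc_prob p (big_cluster alpha)].
End Percolation.

(* Main.v *)
Require Import Defs.
From HB Require Import structures.
From mathcomp Require Import all_boot all_order all_algebra all_fingroup.
From mathcomp Require Import all_classical all_reals all_analysis.
From mathcomp Require Import fintype finset zify ring lra.
Import Order.TTheory GRing.Theory Num.Theory.
Set Implicit Arguments. Unset Strict Implicit. Unset Printing Implicit Defensive.

(** Call two edges close if some endpoints of them are equal or adjacent, and let F
    be a component, for closeness, of the edge boundary of a vertex set. As no
    commutator square meets two components, F is a mod 2 cocycle on those squares.
    Commutativity makes the parity with which a closed word crosses F independent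
    of its base point. So if some closed word of length
    at most 2 diam + 1 crosses F an odd number of times, all its translates meet F,
    and |F| is at least of order |V| / diam, hence of order log |V|. Otherwise F is
    the edge boundary of a vertex set B. Comparing B with a translate by a short
    element that moves F away from itself gives min(|B|, |V \ B|) <= 8 |F|^3.

    Two vertices in different clusters are thus separated by a connected closed
    cut, which is either long or encloses one of them in a small set. There are at
    most |E| C^m connected cuts of size m, so for p close to 1 the expected number
    of enclosed vertices is a small fraction of |V|, and Markov's inequality
    concludes. *)

(** * Connected subsets of a graph of bounded degree, and their number *)

Section ConnectedSets.
Variables (T : finType) (r : rel T).
Hypothesis symr : symmetric r.
Implicit Types (F : {set T}) (x y : T).

Definition rel_in F : rel T := fun x y => [&& x \in F, y \in F & r x y].

Definition conn_set F : bool :=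
  (F != set0) && [forall x in F, forall y in F, connect (rel_in F) x y].

Definition conn_comp F x : {set T} := [set y in F | connect (rel_in F) x y].

Lemma conn_compS F x : conn_comp F x \subset F.
Proof. by apply/subsetP => y; rewrite inE => /andP[]. Qed.

Lemma conn_comp_step F x y z : y \in conn_comp F x -> z \in F -> r y z ->
  z \in conn_comp F x.
Proof.
rewrite !inE => /andP[Fy cxy] Fz ryz; rewrite Fz (connect_trans cxy) //.
by apply: connect1; rewrite /rel_in Fy Fz.
Qed.

Lemma conn_comp_conn F x : x \in F -> conn_set (conn_comp F x).
Proof.
move=> Fx; set C := conn_comp F x.
have Cx : x \in C by rewrite inE Fx connect0.
have conn0 y : y \in C -> connect (rel_in C) x y.
  rewrite inE => /andP[_ /connectP[p pp ->]].
  elim/last_ind: p pp => [|p z IH]; first by rewrite connect0.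
  rewrite rcons_path last_rcons => /andP[pp /and3P[Fl Fz rz]].
  apply: connect_trans (IH pp) (connect1 _).
  have Cl : last x p \in C by rewrite inE Fl; apply/connectP; exists p.
  by rewrite /rel_in Cl rz andbT (conn_comp_step Cl).
have sym_in : symmetric (rel_in C) by move=> y z; rewrite /rel_in symr andbCA.
apply/andP; split; first by apply/set0Pn; exists x.
apply/forall_inP => y Cy; apply/forall_inP => z Cz.
by apply: connect_trans (conn0 _ Cz); rewrite (sym_connect_sym sym_in) conn0.
Qed.

(* The walk goes around a spanning tree of [F]. *)
Lemma conn_set_walk F x : conn_set F -> x \in F ->
  exists p, [/\ path r x p, size p = 2 * #|F|.-1 & F = [set y in x :: p]].
Proof.
move=> /andP[_ /forall_inP connF] Fx.
have grow m : m < #|F| -> exists p,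
    [/\ path r x p, size p = 2 * m, [set y in x :: p] \subset F
      & #|[set y in x :: p]| = m.+1].
  elim: m => [_|m IH ltm].
    exists [::]; split=> //.
      by apply/subsetP => y; rewrite !inE => /eqP->.
    by rewrite -(cards1 x); apply: eq_card => y; rewrite !inE.
  have [p [pp sp sF cF]] := IH (ltnW ltm); set G := [set y in x :: p] in sF cF.
  have [u [v [Gu Fv nGv ruv]]] : exists u v, [/\ u \in G, v \in F, v \notin G & r u v].
    have /properP[_ [z Fz nGz]] : G \proper F by rewrite properEcard sF cF.
    have /connectP[s ps ez] := forall_inP (connF _ Fx) _ Fz.
    have: x \in G by rewrite !inE eqxx.
    elim: s (x) ps ez => [y _ /= ez Gy|y1 s IHs y /= /andP[/and3P[Fy Fy1 ry] ps] ez Gy].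
      by rewrite ez Gy in nGz.
    have [Gy1|nGy1] := boolP (y1 \in G); first exact: IHs ps ez Gy1.
    by exists y, y1.
  have [p1 [p2 [ep lu]]] : exists p1 p2, p = p1 ++ p2 /\ last x p1 = u.
    move: Gu; rewrite /G inE => Gu; clear -Gu.
    by case/splitPl: Gu => p1 p2 lu; exists p1, p2.
  move: pp sp; rewrite ep cat_path lu => /andP[pp1 pp2] sp.
  have eG : [set y in x :: (p1 ++ v :: u :: p2)] = v |: G.
    apply/setP => y; rewrite !inE ep !mem_cat !inE.
    have [->|_] := eqVneq y u; last by case: (y == x); case: (y == v); case: (y \in p1).
    by move: Gu; rewrite inE ep inE mem_cat => ->; rewrite !orbT.
  (* A detour to the new vertex [v] and back, inserted at a visit of [u]: two more steps for one
     more vertex. *)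
  exists (p1 ++ v :: u :: p2); split.
  - by rewrite cat_path pp1 lu /= ruv symr ruv.
  - by move: sp; rewrite !size_cat /=; lia.
  - by rewrite eG subUset sub1set Fv.
  - by rewrite eG cardsU1 nGv cF.
have F0 : 0 < #|F| by apply/card_gt0P; exists x.
have [|p [pp sp sF cF]] := grow #|F|.-1; first by rewrite prednK.
by exists p; split=> //; apply/esym/eqP; rewrite eqEcard sF cF prednK /=.
Qed.

Variables (U : {set T}) (D : nat).
Hypothesis degr : forall x, x \in U -> #|[set y in U | r x y]| <= D.

Fixpoint walks (L : nat) (x : T) : seq (seq T) :=
  if L is L'.+1 then
    flatten [seq [seq y :: p | p <- walks L' y] | y <- enum [set y in U | r x y]]
  else [:: [::]].

Lemma size_walks L x : x \in U -> size (walks L x) <= D ^ L.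
Proof.
elim: L x => // L IH x Ux /=.
rewrite size_flatten /shape -map_comp sumnE big_map big_enum /=.
apply: (@leq_trans (\sum_(y in [set y in U | r x y]) D ^ L)).
  by apply: leq_sum => y; rewrite inE => /andP[Uy _]; rewrite size_map IH.
by rewrite sum_nat_const expnS leq_mul ?degr.
Qed.

Lemma mem_walks x p : path r x p -> {subset p <= U} -> p \in walks (size p) x.
Proof.
elim: p x => //= y p IH x /andP[rxy pp] sp; apply/flatten_mapP; exists y.
  by rewrite mem_enum inE sp ?mem_head.
apply/mapP; exists p => //; apply: IH => // z pz.
by apply: sp; rewrite inE pz orbT.
Qed.

(** Each such set is the vertex set of a walk of length [2 * m] inside [U], and [D] bounds the
    choices at every step of the walk. *)
Lemma card_conn_set m :
  #|[set F : {set T} | [&& F \subset U, conn_set F & #|F| == m.+1]]|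
    <= #|U| * D ^ (2 * m).
Proof.
pose s := flatten [seq [seq [set y in x :: p] | p <- walks (2 * m) x] | x <- enum U].
have : size s <= #|U| * D ^ (2 * m).
  rewrite size_flatten /shape -map_comp sumnE big_map big_enum /= -sum_nat_const.
  by apply: leq_sum => x Ux; rewrite size_map size_walks.
apply: leq_trans; rewrite cardE; apply: uniq_leq_size (enum_uniq _) _ => F.
rewrite mem_enum inE => /and3P[sFU connF /eqP cF].
have /set0Pn[x Fx] : F != set0 by case/andP: connF.
have [p [pp sp eF]] := conn_set_walk connF Fx; rewrite cF /= in sp.
apply/flatten_mapP; exists x; first by rewrite mem_enum (subsetP sFU).
apply/mapP; exists p => //; rewrite -sp; apply: mem_walks => // y py.
by apply: (subsetP sFU); rewrite eF !inE py orbT.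
Qed.

End ConnectedSets.

(** * Generating function of connected sets, and the law of percolation *)

Section GeneratingFunction.
Local Open Scope ring_scope.
Variables (R : realType) (T : finType).

Lemma geometric_le2 (t : R) N : 0 <= t <= 1 / 2 -> \sum_(i < N) t ^+ i <= 2.
Proof.
move=> /andP[t0 t1]; have := subrX1 t N.
have : 0 <= t ^+ N by apply: exprn_ge0.
have : 0 <= \sum_(i < N) t ^+ i by apply: sumr_ge0 => i _; apply: exprn_ge0.
move: (\sum_(i < N) _) => s; nra.
Qed.

(** Grouping the sets by size [m.+1] (they are nonempty) and applying [card_conn_set] leaves
    [#|U| * y] times a geometric series of ratio [D ^ 2 * y]. *)
Lemma sum_conn_set (r : rel T) (U : {set T}) D (y : R) : symmetric r ->
  (forall x, x \in U -> #|[set z in U | r x z]| <= D)%N ->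
  0 <= y -> D%:R ^+ 2 * y <= 1 / 2 ->
  \sum_(F : {set T} | (F \subset U) && conn_set r F) y ^+ #|F| <= 2 * #|U|%:R * y.
Proof.
move=> symr degr y0 yD.
rewrite (partition_big (fun F : {set T} => inord #|F|.-1 : 'I_#|T|.+1) xpredT) //=.
apply: (@le_trans _ _ (\sum_(m < #|T|.+1) #|U|%:R * y * (D%:R ^+ 2 * y) ^+ m)).
  apply: ler_sum => m _.
  have card_eq (F : {set T}) : conn_set r F -> (inord #|F|.-1 == m) = (#|F| == m.+1).
    move=> /andP[F0 _]; rewrite -card_gt0 in F0.
    have lF : (#|F|.-1 < #|T|.+1)%N by have := max_card F; lia.
    by rewrite -val_eqE /= inordK //; apply/eqP/eqP; lia.
  apply: (@le_trans _ _ (\sum_(F in [set F : {set T} |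
      [&& F \subset U, conn_set r F & #|F| == m.+1]]) y ^+ m.+1)).
    rewrite le_eqVlt; apply/orP; left; apply/eqP; apply: eq_big => F.
      rewrite inE -andbA; congr (_ && _).
      by case cF: (conn_set r F) => //=; rewrite card_eq.
    by move=> /andP[/andP[_ cF]]; rewrite card_eq // => /eqP->.
  rewrite sumr_const -[_ *+ _]mulr_natr mulrC.
  have -> : #|U|%:R * y * (D%:R ^+ 2 * y) ^+ m = (#|U| * D ^ (2 * m))%:R * y ^+ m.+1.
    by rewrite natrM natrX exprM exprMn [y ^+ m.+1]exprS; ring.
  by rewrite ler_wpM2r ?exprn_ge0 // ler_nat; apply: card_conn_set.
rewrite -mulr_sumr mulrC -mulrA ler_wpM2r ?mulr_ge0 //.
by apply: geometric_le2; rewrite yD andbT mulr_ge0 ?exprn_ge0.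
Qed.

Lemma sum_powerset (U : {set T}) (p q : R) :
  \sum_(w in powerset U) p ^+ #|w| * q ^+ (#|U| - #|w|) = (p + q) ^+ #|U|.
Proof.
rewrite addrC exprDn.
rewrite (partition_big (fun w : {set T} => inord #|w| : 'I_#|U|.+1) xpredT) //=.
apply: eq_bigr => m _.
transitivity (\sum_(w in [set w : {set T} | (w \subset U) && (#|w| == m)])
                p ^+ m * q ^+ (#|U| - m)).
  have card_eq (w : {set T}) : w \subset U -> (inord #|w| == m) = (#|w| == m).
    by move=> sw; rewrite -val_eqE /= inordK // ltnS subset_leq_card.
  apply: eq_big => w.
    by rewrite powersetE inE; case sw: (w \subset U) => //=; rewrite card_eq.
  by rewrite powersetE => /andP[sw]; rewrite card_eq // => /eqP->.
by rewrite sumr_const cards_draws mulrC.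
Qed.

(** The configurations avoiding [F] are the subsets of [U :\: F]; the closed edges of [F] contribute
    a common factor and the remaining weights sum to one. *)
Lemma perc_closed (U F : {set T}) (p : R) : F \subset U ->
  \sum_(w in powerset U | F \subset U :\: w) p ^+ #|w| * (1 - p) ^+ (#|U| - #|w|)
    = (1 - p) ^+ #|F|.
Proof.
move=> sFU.
transitivity (\sum_(w in powerset (U :\: F))
   (1 - p) ^+ #|F| * (p ^+ #|w| * (1 - p) ^+ (#|U :\: F| - #|w|))).
  apply: eq_big => w.
    rewrite !powersetE !subsetD sFU /= disjoint_sym.
    by case: (w \subset U).
  rewrite powersetE subsetD sFU /= => /andP[swU dFw].
  rewrite mulrCA -exprD; congr (_ * _ ^+ _).
  have: (#|w| <= #|U :\: F|)%N.
    by apply: subset_leq_card; rewrite subsetD swU disjoint_sym.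
  have := subset_leq_card sFU.
  rewrite cardsD (setIidPr sFU); lia.
by rewrite -mulr_sumr sum_powerset subrKC expr1n mulr1.
Qed.

End GeneratingFunction.

(** * Cayley graphs: edges, connectedness, balls and diameter *)

Section CayleyGraph.
Local Open Scope group_scope.
Variables (gT : finGroupType) (S : {set gT}).
Hypothesis genS : <<S>> = [set: gT].
Notation A := (cay_gens S).
Notation E := (gedges (cay_rel S)).

Lemma cay_gensV a : a \in A -> a^-1 \in A.
Proof. by rewrite !inE invg_eq1 invgK orbC. Qed.

Lemma cay_relE x y : cay_rel S x y = (x^-1 * y \in A).
Proof.
have invA z : z \in A -> z^-1 \in A := @cay_gensV z.
by apply/idP/idP => /invA; rewrite invMg invgK.
Qed.

Lemma cay_rel_mul x a : a \in A -> cay_rel S x (x * a).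
Proof. by rewrite cay_relE mulKg. Qed.

Lemma cay_relP x y : reflect (exists2 a, a \in A & y = x * a) (cay_rel S x y).
Proof.
apply: (iffP idP) => [|[a Aa ->]]; last exact: cay_rel_mul.
by rewrite cay_relE => Aa; exists (x^-1 * y); rewrite ?mulKVg.
Qed.

Lemma cay_rel_sym : symmetric (cay_rel S).
Proof.
by move=> x y; apply/cay_relP/cay_relP => -[a Aa ->]; exists a^-1;
  rewrite ?cay_gensV ?mulgK.
Qed.

Lemma card_cay_gens x : #|A| = cay_deg S x.
Proof.
rewrite /cay_deg -(card_imset _ (mulgI x)); apply: eq_card => y.
rewrite inE; apply/imsetP/cay_relP => -[a Aa ->]; by exists a.
Qed.

Lemma gedgesP e :
  reflect (exists x, exists2 a, a \in A & e = [set x; x * a]) (e \in E).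
Proof.
apply: (iffP imset2P) => [[x y _ /cay_relP[a Aa ->] ->]|[x [a Aa ->]]].
  by exists x, a.
by exists x (x * a) => //; apply: cay_rel_mul.
Qed.

Lemma mem_gedges x a : a \in A -> [set x; x * a] \in E.
Proof. by move=> Aa; apply/gedgesP; exists x, a. Qed.

Lemma card_gedges : (#|E| <= #|gT| * #|A|)%N.
Proof.
rewrite -cardsT -cardsX.
apply: leq_trans (leq_imset_card (fun u : gT * gT => [set u.1; u.1 * u.2]) _).
apply/subset_leq_card/subsetP => e /gedgesP[x [a Aa ->]].
by apply/imsetP; exists (x, a) => //; rewrite in_setX inE.
Qed.

Lemma card_cover_gedges (F : {set {set gT}}) :
  F \subset E -> (#|cover F| <= 2 * #|F|)%N.
Proof.
move=> sFE; apply: (@leq_trans (\sum_(e in F) #|e|)%N).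
  by have [] := leq_card_cover F.
rewrite mulnC -sum_nat_const; apply: leq_sum => e /(subsetP sFE).
by move=> /gedgesP[x [a _ ->]]; rewrite cards2; case: eqP.
Qed.

(** The [g] whose right translation maps [B] into itself are closed under products, hence form a
    subgroup by finiteness, and this subgroup contains [S]. *)
Lemma mul_closed_setT (B : {set gT}) x :
  x \in B -> (forall y a, y \in B -> a \in A -> y * a \in B) -> B = [set: gT].
Proof.
move=> Bx clB; pose H := [set g | [forall y in B, y * g \in B]].
have gH : group_set H.
  apply/group_setP; split; first by rewrite inE; apply/forall_inP => y; rewrite mulg1.
  move=> g h; rewrite !inE => /forall_inP Hg /forall_inP Hh.
  by apply/forall_inP => y By; rewrite mulgA Hh ?Hg.
have: <<S>> \subset Group gH.
  rewrite gen_subG; apply/subsetP => s Ss; rewrite inE; apply/forall_inP => y By.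
  have [->|s1] := eqVneq s 1; first by rewrite mulg1.
  by apply: clB; rewrite // !inE s1 Ss.
rewrite genS => /subsetP sH; apply/setP => y; rewrite inE.
have := sH (x^-1 * y) (in_setT _); rewrite inE => /forall_inP/(_ _ Bx).
by rewrite mulKVg.
Qed.

(** Balls grow strictly with the radius until one is stable under the generators, and such a ball is
    the whole group. *)
Lemma gball_card x r : (minn r.+1 #|gT| <= #|gball (cay_rel S) x r|)%N.
Proof.
elim: r => [|r IH] /=; first by rewrite cards1 geq_minl.
set B := gball _ x r in IH *; set B' := _ :|: _.
have sBB' : B \subset B' by apply: finset.subsetUl.
have [eBB'|nBB'] := eqVneq B B'.
  suff -> : B' = [set: gT] by rewrite cardsT geq_minr.
  have Bx : x \in B by rewrite /B; elim: (r) => [|q IHq] /=; rewrite !inE ?eqxx ?IHq.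
  rewrite -eBB'; apply: (mul_closed_setT Bx) => y a By Aa.
  rewrite eBB' !inE; apply/orP; right.
  by apply/existsP; exists y; rewrite By cay_rel_mul.
have step a b c n : (minn a.+1 n <= b -> b < c -> minn a.+2 n <= c)%N by lia.
by apply: step IH _; apply: proper_card; rewrite properEneq nBB'.
Qed.

Lemma gball_mono x r r' y : (r <= r')%N ->
  y \in gball (cay_rel S) x r -> y \in gball (cay_rel S) x r'.
Proof.
move=> /subnK <-; elim: (r' - r)%N => // d IH /IH; rewrite addSn /= inE => ->.
by [].
Qed.

Lemma gball_word x r y : y \in gball (cay_rel S) x r ->
  exists w : seq gT, [/\ (size w <= r)%N, all (mem A) w & y = foldl mulg x w].
Proof.
elim: r y => [|r IH] y /=; first by rewrite inE => /eqP ->; exists [::].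
rewrite !inE => /orP[/IH[w [sw Aw ->]]|/existsP[z /andP[/IH[w [sw Aw ->]]]]].
  by exists w; split => //; apply: leqW.
move=> /cay_relP[a Aa ->]; exists (rcons w a).
by rewrite size_rcons all_rcons Aw foldl_rcons /= andbT Aa.
Qed.

Lemma mem_gball_gdiam x y : y \in gball (cay_rel S) x (gdiam (cay_rel S)).
Proof.
have n0 : (0 < #|gT|)%N by apply/card_gt0P; exists x.
(* The search defining [gdist] succeeds, so its value is a genuine radius and not the default
   [#|gT|]. *)
have hasy : has (fun r => y \in gball (cay_rel S) x r) (iota 0 #|gT|).
  apply/hasP; exists #|gT|.-1; first by rewrite mem_iota; lia.
  have := gball_card x #|gT|.-1; rewrite prednK // minnn => cB.
  suff -> : gball (cay_rel S) x #|gT|.-1 = [set: gT] by rewrite inE.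
  by apply/eqP; rewrite eqEcard subsetT cardsT.
have : (gdist (cay_rel S) x y <= gdiam (cay_rel S))%N.
  rewrite /gdiam.
  apply: leq_trans (leq_bigmax (F := fun x => \max_y gdist (cay_rel S) x y) x).
  exact: (leq_bigmax (F := gdist (cay_rel S) x) y).
move/gball_mono; apply.
have := nth_find 0 hasy; move: hasy; rewrite has_find size_iota => lt_find.
by rewrite nth_iota.
Qed.

Lemma gdiam_gt0 : (1 < #|gT|)%N -> (0 < gdiam (cay_rel S))%N.
Proof.
move=> n1; rewrite lt0n; apply/eqP => D0; move: n1.
suff: [set: gT] \subset [set 1].
  by move/subset_leq_card; rewrite cardsT cards1 leqNgt => /negP.
by apply/subsetP => y _; have := mem_gball_gdiam 1 y; rewrite D0.
Qed.

End CayleyGraph.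

(** * Edge boundaries of vertex sets *)

Section EdgeBoundary.
Local Open Scope group_scope.
Variables (gT : finGroupType) (S : {set gT}).
Hypotheses (abG : abelian [set: gT]) (genS : <<S>> = [set: gT]).
Notation A := (cay_gens S).
Notation E := (gedges (cay_rel S)).
Implicit Types (F : {set {set gT}}) (B : {set gT}) (w : seq gT).

Lemma abelian_mulgC (x y : gT) : x * y = y * x.
Proof. by apply: (centsP abG); rewrite inE. Qed.

Definition bd B : {set {set gT}} :=
  [set e in E | [exists x in e, exists y in e, (x \in B) && (y \notin B)]].

Lemma bd_sub B : bd B \subset E.
Proof. by apply/subsetP => e; rewrite inE => /andP[]. Qed.

Lemma mem_bd B x a : a \in A ->
  ([set x; x * a] \in bd B) = (x \in B) (+) (x * a \in B).
Proof.
move=> Aa; rewrite inE mem_gedges //=.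
apply/existsP/idP => [[u /andP[+ /existsP[v /andP[]]]]|].
  by rewrite !inE => /orP[/eqP->|/eqP->] /orP[/eqP->|/eqP->];
    case: (x \in B); case: (x * a \in B).
case Bx: (x \in B) => /=.
  by move=> nB; exists x; rewrite !inE eqxx; apply/existsP; exists (x * a);
    rewrite !inE eqxx orbT Bx.
by move=> nB; exists (x * a); rewrite !inE eqxx orbT; apply/existsP; exists x;
    rewrite !inE eqxx Bx nB.
Qed.

Lemma eq_bdP B F : F \subset E ->
  (forall x a, a \in A -> ([set x; x * a] \in F) = (x \in B) (+) (x * a \in B)) ->
  bd B = F.
Proof.
move=> sFE eF; apply/setP => e; apply/idP/idP.
  move=> Be; have /gedgesP[x [a Aa ee]] := subsetP (bd_sub B) _ Be.
  by move: Be; rewrite ee mem_bd // eF.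
move=> Fe; have /gedgesP[x [a Aa ee]] := subsetP sFE _ Fe.
by move: Fe; rewrite ee mem_bd // eF.
Qed.

Lemma mul_invariant_const (P : pred gT) x y :
  (forall z a, a \in A -> P z = P (z * a)) -> P x = P y.
Proof.
move=> cP; pose B := [set z | P z == P x].
have BT : B = [set: gT].
  apply: (mul_closed_setT genS (x := x)); first by rewrite inE.
  by move=> z a + Aa; rewrite !inE -cP.
by have := in_setT y; rewrite -BT inE => /eqP.
Qed.

(** The symmetric difference of [B] and [B'] has no boundary, so it is empty or everything: [B'] is
    [B] or its complement. *)
Lemma eq_bd_sep B B' x y : bd B = bd B' ->
  (x \in B) (+) (y \in B) = (x \in B') (+) (y \in B').
Proof.
move=> eB; have : (x \in B) (+) (x \in B') = (y \in B) (+) (y \in B').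
  apply: (mul_invariant_const (P := fun z => (z \in B) (+) (z \in B'))) => z a Aa.
  have := mem_bd B z Aa; rewrite eB mem_bd //.
  by do 4!case: (_ \in _).
by do 4!case: (_ \in _).
Qed.

Lemma bd_neq0 B x y : x \in B -> y \notin B -> bd B != set0.
Proof.
move=> Bx nBy; apply/eqP => B0.
have e0 : bd B = bd set0.
  by rewrite B0; apply/esym/eq_bdP => [|z a _]; rewrite ?sub0set // !inE.
by have := eq_bd_sep x y e0; rewrite Bx (negbTE nBy) !inE.
Qed.

(** * Parity with which a word crosses an edge set, and exactness of small cocycles *)

Fixpoint crossing F x w : bool :=
  if w is a :: w' then ([set x; x * a] \in F) (+) crossing F (x * a) w' else false.

Lemma crossing_cat F x w w' :
  crossing F x (w ++ w') = crossing F x w (+) crossing F (foldl mulg x w) w'.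
Proof. by elim: w x => //= a w IH x; rewrite IH addbA. Qed.

Lemma foldl_mulg (x : gT) w : foldl mulg x w = x * foldl mulg 1 w.
Proof.
elim/last_ind: w => [|w a IH]; first by rewrite /= mulg1.
by rewrite !foldl_rcons IH mulgA.
Qed.

(** An odd crossing puts some letter of [w] on an edge of [F]. The position of this letter and the
    endpoint from which it starts determine the base point. *)
Lemma card_crossing F w : F \subset E ->
  (#|[set x | crossing F x w]| <= size w * (2 * #|F|))%N.
Proof.
move=> sFE; elim: w => [|a w IH] /=.
  by rewrite leqn0 cards_eq0; apply/eqP/setP => x; rewrite !inE.
rewrite mulSn; apply: leq_trans (leq_add (card_cover_gedges sFE) IH).
rewrite -[X in (_ <= _ + X)%N](card_imset _ (mulIg a^-1)).
apply: leq_trans (leq_card_setU _ _); apply/subset_leq_card/subsetP => x.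
rewrite !inE; case Fxa: (_ \in F) => /= cx; apply/orP.
  by left; apply/bigcupP; exists [set x; x * a]; rewrite // !inE eqxx.
by right; apply/imsetP; exists (x * a); rewrite ?inE ?mulgK.
Qed.

(* Cocycle condition on the commutator squares of the Cayley complex. *)
Definition square_closed F := forall x a b, a \in A -> b \in A ->
  ([set x; x * a] \in F) (+) ([set x * a; x * a * b] \in F) =
  ([set x; x * b] \in F) (+) ([set x * b; x * b * a] \in F).

Lemma bd_square_closed B : square_closed (bd B).
Proof.
move=> x a b Aa Ab; rewrite !mem_bd // -!mulgA (abelian_mulgC a b).
by do 4!case: (_ \in _).
Qed.

(** The letter [a] moves past the letters of [w] one at a time, each exchange being a commutator
    square. *)
Lemma crossing_comm F x a w : square_closed F -> a \in A -> all (mem A) w ->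
  crossing F x (a :: w) = crossing F x (rcons w a).
Proof.
move=> sqF Aa; elim: w x => //= b w IH x /andP[Ab Aw].
rewrite -IH //= !addbA sqF //; congr (_ (+) _).
by rewrite -!mulgA (abelian_mulgC a b).
Qed.

(** In [a :: w] and [rcons w a], read from [z], the letter [a] uses the same edge because [w] is
    closed. It cancels, leaving [w] read from [z * a] against [w] read from [z]. *)
Lemma crossing_closed F x y w : square_closed F -> all (mem A) w ->
  foldl mulg 1 w = 1 -> crossing F x w = crossing F y w.
Proof.
move=> sqF Aw w1; apply: (mul_invariant_const (P := fun z => crossing F z w)) => z a Aa.
have := crossing_comm z sqF Aa Aw; rewrite -cats1 crossing_cat /= addbF.
rewrite foldl_mulg w1 mulg1.
by case: crossing; case: crossing; case: (_ \in F).
Qed.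

Lemma foldl_mulg_rev (x : gT) w :
  foldl mulg (foldl mulg x w) (rev [seq a^-1 | a <- w]) = x.
Proof.
by elim: w x => //= b w IH z; rewrite rev_cons foldl_rcons IH mulgK.
Qed.

Lemma crossing_rev F x w :
  crossing F (foldl mulg x w) (rev [seq a^-1 | a <- w]) = crossing F x w.
Proof.
elim: w x => //= a w IH x; rewrite rev_cons -cats1 crossing_cat IH /=.
by rewrite foldl_mulg_rev mulgK setUC addbF addbC.
Qed.

(* A closed word crosses [F] with the same parity from every base point, so if
   that parity is odd then the #|gT| translates of the word all meet [F]. *)
Lemma square_closed_bd F D :
  (forall x : gT, exists w, [/\ (size w <= D)%N, all (mem A) w & x = foldl mulg 1 w]) ->
  F \subset E -> square_closed F -> ((2 * D).+1 * (2 * #|F|) < #|gT|)%N ->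
  exists B, bd B = F.
Proof.
move=> /choice[W HW] sFE sqF small.
have even0 w x : all (mem A) w -> (size w <= (2 * D).+1)%N ->
    foldl mulg 1 w = 1 -> crossing F x w = false.
  move=> Aw sw w1; apply/negP => cx; move: small; apply/negP; rewrite -leqNgt.
  apply: leq_trans (leq_mul sw (leqnn _)).
  apply: leq_trans (card_crossing w sFE).
  rewrite -cardsT; apply/subset_leq_card/subsetP => y _.
  by rewrite inE (crossing_closed y x).
(* A primitive of [F]: the parity along a chosen word from [1] to [x]. The closed word made of
   [W x], [a] and [W (x * a)] backwards has length at most [(2 * D).+1], so its parity is even. *)
exists [set x | crossing F 1 (W x)]; apply: eq_bdP => // x a Aa; rewrite !inE.
have [s1 A1 e1] := HW x; have [s2 A2 e2] := HW (x * a).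
have := even0 (W x ++ a :: rev [seq b^-1 | b <- W (x * a)]) 1.
rewrite all_cat A1 /= Aa all_rev size_cat /= size_rev size_map.
rewrite crossing_cat /= -e1 foldl_cat /= -e1.
move: (crossing_rev F 1 (W (x * a))) (foldl_mulg_rev 1 (W (x * a))).
rewrite -e2 => -> ->.
have -> : all (mem A) [seq b^-1 | b <- W (x * a)].
  by rewrite all_map; apply: sub_all A2 => b /=; apply: cay_gensV.
rewrite mul2n -addnn addnS ltnS leq_add // => /(_ isT isT erefl).
by case: crossing; case: crossing; case: (_ \in F).
Qed.

End EdgeBoundary.

(** * Connected cuts: existence and isoperimetry *)

Section ConnectedCuts.
Local Open Scope group_scope.
Variables (gT : finGroupType) (S : {set gT}).
Hypotheses (abG : abelian [set: gT]) (genS : <<S>> = [set: gT]).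
Notation A := (cay_gens S).
Notation E := (gedges (cay_rel S)).
Notation bd := (bd S).
Implicit Types (F : {set {set gT}}) (B : {set gT}) (e : {set gT}).

(** Coarse enough to relate any two edges of a commutator square, yet with a number of neighbours
    bounded in terms of the degree, so that connected cuts can be counted. *)
Definition close : rel {set gT} :=
  fun e e' => [exists u in e, exists v in e', (u == v) || cay_rel S u v].

Lemma closeP e e' :
  reflect (exists u v, [/\ u \in e, v \in e' & (u == v) || cay_rel S u v])
          (close e e').
Proof.
apply: (iffP existsP) => [[u /andP[eu /existsP[v /andP[ev uv]]]]|[u [v [eu ev uv]]]].
  by exists u, v.
by exists u; rewrite eu; apply/existsP; exists v; rewrite ev.
Qed.

Lemma close_sym : symmetric close.
Proof.
by move=> e e'; apply/closeP/closeP => -[u [v [eu ev uv]]]; exists v, u;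
  rewrite eq_sym cay_rel_sym.
Qed.

(** A component contains either all the edges of [F] on a given square or none of them. *)
Lemma conn_comp_square_closed F e0 :
  square_closed S F -> square_closed S (conn_comp close F e0).
Proof.
move=> sqF x a b Aa Ab; have := sqF x a b Aa Ab; set C := conn_comp close F e0.
set e1 := [set x; _]; set e2 := [set x * a; _].
set e3 := [set x; _]; set e4 := [set x * b; _] => sq.
(* Every edge of the square contains [x * a] or [x * b], and also [x] or [x * a * b]; each of the
   first two vertices is adjacent to each of the last two. *)
have cl e e' : e \in [:: e1; e2; e3; e4] -> e' \in [:: e1; e2; e3; e4] -> close e e'.
  move=> he he'; have [c Ac ec] : exists2 c, c \in [:: a; b] & x * c \in e.
    move: he; rewrite !inE => /or4P[]/eqP->.
    - by exists a; rewrite !inE eqxx ?orbT.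
    - by exists a; rewrite !inE eqxx ?orbT.
    - by exists b; rewrite !inE eqxx ?orbT.
    - by exists b; rewrite !inE eqxx ?orbT.
  have : (x \in e') || (x * a * b \in e').
    have ab : x * b * a = x * a * b by rewrite -!mulgA (abelian_mulgC abG a b).
    by move: he'; rewrite !inE => /or4P[]/eqP->; rewrite !inE ?ab eqxx ?orbT.
  case/orP => e'v; apply/closeP.
    exists (x * c), x; split => //; rewrite cay_rel_sym cay_rel_mul ?orbT //.
    by move: Ac; rewrite in_cons mem_seq1 => /orP[]/eqP->.
  exists (x * c), (x * a * b); split => //; apply/orP; right; move: Ac.
  rewrite in_cons mem_seq1 => /orP[]/eqP->; first exact: cay_rel_mul.
  by rewrite -mulgA (abelian_mulgC abG a b) mulgA cay_rel_mul.
have [/hasP[e he Ce]|/hasPn nC] := boolP (has (mem C) [:: e1; e2; e3; e4]).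
  have CF e' : e' \in [:: e1; e2; e3; e4] -> (e' \in C) = (e' \in F).
    move=> he'; apply/idP/idP => [/(subsetP (conn_compS _ _ _)) //|Fe'].
    exact: conn_comp_step Ce Fe' (cl _ _ he he').
  by rewrite !CF // !inE eqxx ?orbT.
have nCe e' : e' \in [:: e1; e2; e3; e4] -> (e' \in C) = false.
  by move=> /nC/negbTE.
by rewrite !nCe // !inE eqxx ?orbT.
Qed.

Lemma bdC B : bd (~: B) = bd B.
Proof.
apply: eq_bdP; first exact: bd_sub.
by move=> x a Aa; rewrite mem_bd // !inE; case: (_ \in B); case: (_ \in B).
Qed.

(** Take a separating set with the fewest boundary edges. If a component of its boundary were
    proper, it would bound some [B1], and either [B1] or the symmetric difference with [B1] would
    separate [x] from [y] with fewer edges. *)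
Lemma min_cut_conn (Z : {set {set gT}}) B0 x y :
  (forall F, conn_set close F -> F \subset Z -> F \subset E -> square_closed S F ->
     exists B, bd B = F) ->
  x \in B0 -> y \notin B0 -> bd B0 \subset Z ->
  exists B, [/\ x \in B, y \notin B, bd B \subset Z & conn_set close (bd B)].
Proof.
move=> exF B0x B0y sZ.
pose P B := [&& x \in B, y \notin B & bd B \subset Z].
have PB0 : P B0 by rewrite /P B0x B0y.
have [B /and3P[Bx By sBZ] minB] := arg_minnP (fun B => #|bd B|) PB0.
exists B; split => //; have /set0Pn[e0 Be0] := bd_neq0 genS Bx By.
set C := conn_comp close (bd B) e0.
have connC : conn_set close C by exact: (conn_comp_conn close_sym).
have sCB : C \subset bd B := conn_compS _ _ _.
have sqC : square_closed S C.
  by apply: conn_comp_square_closed; apply: bd_square_closed.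
have [eC|neC] := eqVneq C (bd B); first by rewrite -eC.
have ltC : (#|C| < #|bd B|)%N by apply: proper_card; rewrite properEneq neC.
have [B1 bB1] : exists B, bd B = C.
  apply: exF => //; first exact: subset_trans sCB sBZ.
  exact: subset_trans sCB (bd_sub _ _).
have [sep|nsep] := boolP ((x \in B1) (+) (y \in B1)).
  pose B2 := if x \in B1 then B1 else ~: B1.
  have bB2 : bd B2 = C by rewrite /B2; case: ifP; rewrite ?bdC.
  suff /minB : P B2 by rewrite bB2 leqNgt ltC.
  rewrite /P bB2 (subset_trans sCB sBZ) /B2 andbT; move: sep.
  by case: ifP => B1x; rewrite ?in_setC B1x /= ?negbK => ->.
(* The last term complements the symmetric difference when needed to keep [x] inside. *)
pose B2 := [set z | (z \in B) (+) (z \in B1) (+) (x \in B1)].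
have mB2 z : (z \in B2) = (z \in B) (+) (z \in B1) (+) (x \in B1) by rewrite inE.
have bB2 : bd B2 = bd B :\: C.
  apply: eq_bdP => [|z a Aa]; first exact: subset_trans (subsetDl _ _) (bd_sub _ _).
  rewrite in_setD !mB2.
  have := subsetP sCB [set z; z * a]; rewrite -bB1 !mem_bd //.
  by do 5!case: (_ \in _) => //=; move=> /(_ isT).
have C0 : (0 < #|C|)%N by rewrite card_gt0; case/andP: connC.
suff /minB : P B2.
  by rewrite bB2 cardsD (setIidPr sCB) leqNgt ltn_subrL C0 (leq_ltn_trans _ ltC).
rewrite /P bB2 (subset_trans (subsetDl _ _) sBZ) andbT !inE Bx (negbTE By).
by move: nsep; case: (x \in B1); case: (y \in B1).
Qed.

Lemma crossing_bd B x w : all (mem A) w ->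
  crossing (bd B) x w = (x \in B) (+) (foldl mulg x w \in B).
Proof.
elim: w x => [x _|a w IH x /= /andP[Aa Aw]]; first by rewrite /= addbb.
by rewrite IH // mem_bd // addbA addbK.
Qed.

Lemma mem_cover_bd B x a : a \in A -> (x \in B) != (x * a \in B) ->
  (x \in cover (bd B)) && (x * a \in cover (bd B)).
Proof.
move=> Aa neB; have eB : [set x; x * a] \in bd B.
  by rewrite mem_bd //; move: neB; do 2!case: (_ \in B).
by apply/andP; split; apply/bigcupP; exists [set x; x * a]; rewrite // !inE eqxx ?orbT.
Qed.

(** Follow a chain of close edges from [u] to [v]. Each move starts in the cover and stays put or
    follows a graph edge, whose translate by [h] has an endpoint off the cover and so does not cross
    [bd B]. *)
Lemma bd_translate_const B h u v : conn_set close (bd B) ->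
  (forall z, z \in cover (bd B) -> z * h \notin cover (bd B)) ->
  u \in cover (bd B) -> v \in cover (bd B) -> (u * h \in B) = (v * h \in B).
Proof.
move=> /andP[_ connB] disj /bigcupP[e Be eu] /bigcupP[e' Be' e'v].
have cover_mem f z : f \in bd B -> z \in f -> z \in cover (bd B).
  by move=> Bf fz; apply/bigcupP; exists f.
have adj z z' : z \in cover (bd B) -> (z == z') || cay_rel S z z' ->
    (z * h \in B) = (z' * h \in B).
  move=> Vz /orP[/eqP-> //|/cay_relP[a Aa ->]].
  rewrite -mulgA (abelian_mulgC abG a) mulgA; apply/eqP/negPn/negP.
  by move=> /(mem_cover_bd Aa)/andP[Vzh _]; have := disj _ Vz; rewrite Vzh.
have edge f z z' : f \in bd B -> z \in f -> z' \in f -> (z * h \in B) = (z' * h \in B).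
  move=> Bf fz fz'; apply: adj; first exact: cover_mem fz.
  have /gedgesP[x [a Aa ef]] := subsetP (bd_sub _ _) _ Bf.
  move: fz fz'; rewrite ef !inE => /orP[/eqP->|/eqP->] /orP[/eqP->|/eqP->];
    by rewrite ?eqxx // ?(cay_rel_sym S (x * a)) cay_rel_mul ?orbT.
have /connectP[p] := forall_inP (forall_inP connB _ Be) _ Be'.
elim: p e Be u eu => [|e1 p IH] e Be u eu /=.
  by move=> _ ee'; apply: (edge e); rewrite // -ee'.
move=> /andP[/and3P[_ Be1 /closeP[z [z' [ez ez' zz']]]] pp] el.
rewrite (edge e u z) // (adj z z') ?(IH e1 _ z') //.
exact: cover_mem ez.
Qed.

(* Translate by a short [g] that moves [cover (bd B)] off itself. Then [B] and
   its translate are disjoint, cover the group, or are nested; being of equal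
   size, nested sets coincide. *)
Lemma bd_isoperimetry B (m := #|bd B|) : conn_set close (bd B) ->
  (4 * m ^ 2 < #|gT|)%N -> (#|B| <= 8 * m ^ 3)%N \/ (#|~: B| <= 8 * m ^ 3)%N.
Proof.
move=> connB small; set V := cover (bd B).
have cardV : (#|V| <= 2 * m)%N by apply: card_cover_gedges; apply: bd_sub.
(* The quotients of [V]: an element outside [N] translates [V] off itself. A ball of radius
   [4 * m ^ 2] has more elements than [N]. *)
pose N := (fun u : gT * gT => u.1^-1 * u.2) @: setX V V.
have cardN : (#|N| <= 4 * m ^ 2)%N.
  apply: leq_trans (leq_imset_card _ _) _; rewrite cardsX.
  by apply: leq_trans (leq_mul cardV cardV) _; lia.
have [g Bg Ng] : exists2 g, g \in gball (cay_rel S) 1 (4 * m ^ 2) & g \notin N.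
  apply/subsetPn; apply/negP => /subset_leq_card.
  have := gball_card genS 1 (4 * m ^ 2); rewrite (minn_idPl small) => h1 h2.
  by have := leq_ltn_trans cardN (leq_trans h1 h2); rewrite ltnn.
have [w [sw Aw eg]] := gball_word Bg.
pose B' := [set x | x * g \in B].
have cardB' : #|B'| = #|B|.
  rewrite -[RHS](card_imset _ (mulIg g^-1)); apply: eq_card => x; rewrite inE.
  apply/idP/imsetP => [Bxg|[y By ->]]; last by rewrite mulgKV.
  by exists (x * g); rewrite ?mulgK.
(* Where [B] and [B'] differ, the word for [g] crosses [bd B] oddly; its length is at most
   [4 * m ^ 2] and each letter accounts for at most [2 * m] points. *)
have cardD : (#|[set x | (x \in B) (+) (x \in B')]| <= 8 * m ^ 3)%N.
  have := card_crossing w (bd_sub S B); rewrite -/m => cw.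
  apply: leq_trans (leq_trans cw _).
    apply/subset_leq_card/subsetP => x.
    by rewrite !inE crossing_bd // (foldl_mulg x) -eg.
  by apply: leq_trans (leq_mul sw (leqnn _)) _; lia.
have disj h : h = g \/ h = g^-1 -> forall z, z \in V -> z * h \notin V.
  move=> hg z Vz; apply: contraNN Ng => Vzh; apply/imsetP.
  case: hg Vzh => -> Vzh; first by exists (z, z * g); rewrite ?inE ?Vz ?mulKg.
  by exists (z * g^-1, z); rewrite ?inE ?Vz ?Vzh // invMg invgK mulgKV.
have /set0Pn[e0 Be0] : bd B != set0 by case/andP: connB.
have /gedgesP[x0 [a0 Aa0 ee0]] := subsetP (bd_sub _ _) _ Be0.
have neB0 : (x0 \in B) != (x0 * a0 \in B).
  by move: Be0; rewrite ee0 mem_bd //; do 2!case: (_ \in B).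
have /andP[Vx0 Vx1] := mem_cover_bd Aa0 neB0.
pose p := x0 * g \in B; pose p' := x0 * g^-1 \in B.
have Vp x : x \in V -> (x * g \in B) = p.
  by move=> Vx; apply: bd_translate_const => //; apply: disj; left.
have Vp' x : x * g \in V -> (x \in B) = p'.
  move=> Vx; rewrite -{1}[x](mulgK g).
  by apply: bd_translate_const => //; apply: disj; right.
(* One of the four corners cut out by [B] and [B'] is empty: along edges of [bd B] the second factor
   vanishes, along edges of [bd B'] the first, so the conjunction is constant, and it is false at
   [x0]. *)
have none x : ~~ (((x \in B) (+) p') && ((x \in B') (+) p)).
  have -> : (((x \in B) (+) p') && ((x \in B') (+) p)) =
            (((x0 \in B) (+) p') && ((x0 \in B') (+) p)).
    apply: (mul_invariant_const genS
      (P := fun x => ((x \in B) (+) p') && ((x \in B') (+) p))).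
    move=> z a Aa; rewrite /B' !inE.
    have [eB|/(mem_cover_bd Aa)/andP[Vz Vza]] :=
      eqVneq (z \in B) (z * a \in B); last first.
      by rewrite !Vp // addbb !andbF.
    have aC : z * a * g = z * g * a by rewrite -!mulgA (abelian_mulgC abG a).
    have [eB'|] := eqVneq (z * g \in B) (z * g * a \in B); first by rewrite eB aC eB'.
    move=> /(mem_cover_bd Aa)/andP[Vz Vza].
    by rewrite (Vp' z) // (Vp' (z * a)) ?aC // addbb.
  by rewrite [x0 \in B']inE addbb andbF.
have neq : B <> B'.
  by move=> eB; move: neB0; rewrite eB !inE Vp ?Vp ?eqxx.
have le_card (Y : {set gT}) :
    Y \subset [set x | (x \in B) (+) (x \in B')] -> (#|Y| <= 8 * m ^ 3)%N.
  by move=> sY; apply: leq_trans (subset_leq_card sY) cardD.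
(* In order: [B] and [B'] cover the group, [B] lies in [B'], [B'] lies in [B], they are disjoint. *)
case ep : p none => none; case ep' : p' none => none.
- right; apply: le_card; apply/subsetP => x; have := none x; rewrite !inE.
  by do 2!case: (_ \in B).
- case: neq; apply/eqP; rewrite eqEcard cardB' leqnn andbT.
  by apply/subsetP => x; have := none x; rewrite !inE; do 2!case: (_ \in B).
- case: neq; apply/esym/eqP; rewrite eqEcard cardB' leqnn andbT.
  by apply/subsetP => x; have := none x; rewrite !inE; do 2!case: (_ \in B).
- left; apply: le_card; apply/subsetP => x; have := none x; rewrite !inE.
  by do 2!case: (_ \in B).
Qed.

End ConnectedCuts.

Lemma leq_card_bigcup (I T : finType) (P : pred I) (G : I -> {set T}) :
  #|\bigcup_(i | P i) G i| <= \sum_(i | P i) #|G i|.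
Proof.
elim/big_rec2: _ => [|i n X _ IH]; first by rewrite cards0.
by apply: leq_trans (leq_card_setU _ _) _; rewrite leq_add2l.
Qed.

(** * A large cluster when closed cuts are short and enclose little *)

Section GiantCluster.
Local Open Scope group_scope.
Variables (gT : finGroupType) (S : {set gT}).
Hypotheses (abG : abelian [set: gT]) (genS : <<S>> = [set: gT]).
Notation A := (cay_gens S).
Notation E := (gedges (cay_rel S)).
Notation bd := (bd S).
Notation close := (close S).

(** A close edge is given by an endpoint of [e], a factor in [1 |: A] leading to one of its own
    endpoints, and a generator along it. *)
Lemma card_close e : e \in E ->
  (#|[set e' in E | close e e']| <= 2 * #|A|.+1 * #|A|)%N.
Proof.
move=> Ee.
pose f (u : gT * gT * gT) := [set u.1.1 * u.1.2; u.1.1 * u.1.2 * u.2].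
have card_e : (#|e| <= 2)%N.
  by have /gedgesP[x [a _ ->]] := Ee; rewrite cards2; case: eqP.
have card_A1 : (#|1%g |: A| <= #|A|.+1)%N by rewrite cardsU1; case: (_ \notin _).
apply: (@leq_trans #|f @: setX (setX e (1 |: A)) A|); last first.
  by apply: leq_trans (leq_imset_card _ _) _; rewrite !cardsX !leq_mul.
apply/subset_leq_card/subsetP => e'; rewrite inE => /andP[/gedgesP[y [c Ac ->]]].
move=> /closeP[u [v [eu ve' uv]]].
have [b A1b ev] : exists2 b, b \in 1 |: A & v = u * b.
  case/orP: uv => [/eqP<-|/cay_relP[b Ab ->]].
    by exists 1; rewrite ?mulg1 // setU11.
  by exists b; rewrite // in_setU Ab orbT.
apply/imsetP; move: ve'; rewrite in_set2 => /orP[]/eqP yv.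
  by exists (u, b, c); rewrite ?in_setX ?eu ?A1b //= /f /= -ev yv.
exists (u, b, c^-1); first by rewrite !in_setX eu A1b cay_gensV.
by rewrite /f /= -ev yv mulgK setUC.
Qed.

Lemma cluster_bd (w : {set {set gT}}) x :
  bd (Defs.cluster (cay_rel S) w x) \subset E :\: w.
Proof.
apply/subsetP => e be; have Ee := subsetP (bd_sub _ _) _ be.
rewrite in_setD Ee andbT; apply/negP => we; move: be.
have /gedgesP[y [a Aa ee]] := Ee; rewrite ee mem_bd // !inE.
have o1 : open_rel (cay_rel S) w y (y * a).
  by rewrite /open_rel cay_rel_mul //= -ee.
have o2 : open_rel (cay_rel S) w (y * a) y.
  by rewrite /open_rel cay_rel_sym cay_rel_mul //= setUC -ee.
have -> : connect (open_rel (cay_rel S) w) x y =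
          connect (open_rel (cay_rel S) w) x (y * a).
  by apply/idP/idP => cxy; apply: connect_trans cxy (connect1 _).
by rewrite addbb.
Qed.

(** All vertices outside the small sets enclosed by closed connected cuts share a cluster: otherwise
    a connected closed cut would separate two of them, and its small side would contain one. *)
Lemma large_cluster (w : {set {set gT}}) :
  (forall F, conn_set close F -> F \subset E :\: w ->
     ((2 * gdiam (cay_rel S)).+1 * (2 * #|F|) < #|gT|)%N /\
     (4 * #|F| ^ 2 < #|gT|)%N) ->
  exists x, (#|gT| <= #|Defs.cluster (cay_rel S) w x| +
    \sum_(F : {set {set gT}} | conn_set close F && (F \subset E :\: w))
       8 * #|F| ^ 3)%N.
Proof.
move=> small.
(* One small side is chosen per cut, with the empty set as default if there is none. *)
pose sm (F : {set {set gT}}) : {set gT} :=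
  odflt set0 [pick B | (bd B == F) && (#|B| <= 8 * #|F| ^ 3)%N].
have card_sm F : (#|sm F| <= 8 * #|F| ^ 3)%N.
  by rewrite /sm; case: pickP => [B /andP[]|]; rewrite //= cards0.
pose Bad := \bigcup_(F | conn_set close F && (F \subset E :\: w)) sm F.
have card_Bad : (#|Bad| <= \sum_(F : {set {set gT}} |
    conn_set close F && (F \subset E :\: w)) 8 * #|F| ^ 3)%N.
  by apply: leq_trans (leq_card_bigcup _ _) _; apply: leq_sum.
suff [x sx] : exists x, ~: Bad \subset Defs.cluster (cay_rel S) w x.
  exists x; rewrite -(cardsC Bad) addnC.
  exact: leq_add (subset_leq_card sx) card_Bad.
have [Bad0|/set0Pn[x]] := eqVneq (~: Bad) set0.
  by exists 1; rewrite Bad0 sub0set.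
rewrite in_setC => nBx; exists x; apply/subsetP => y; rewrite in_setC => nBy.
apply/negPn/negP => nCy.
have Cx : x \in Defs.cluster (cay_rel S) w x by rewrite inE connect0.
have exactF (F : {set {set gT}}) : conn_set close F -> F \subset E :\: w ->
    F \subset E -> square_closed S F -> exists B, bd B = F.
  move=> cF sF sFE sqF; have [smallF _] := small F cF sF.
  apply: (square_closed_bd abG genS _ sFE sqF smallF) => z.
  exact: gball_word (mem_gball_gdiam genS 1 z).
have [B [Bx By sB cB]] := min_cut_conn abG genS exactF Cx nCy (cluster_bd w x).
have [_ smallB] := small _ cB sB.
(* The chosen side may be [B] or its complement; only its boundary matters for separating [x] from
   [y]. *)
have [B1 [bB1 eB1]] : exists B1, bd B1 = bd B /\ sm (bd B) = B1.
  have [B2 B2P] : exists B2, (bd B2 == bd B) && (#|B2| <= 8 * #|bd B| ^ 3)%N.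
    case: (bd_isoperimetry abG genS cB smallB) => le3; first by exists B; rewrite eqxx.
    by exists (~: B); rewrite bdC eqxx.
  rewrite /sm; case: pickP => [B1 /andP[/eqP bB1 _]|/(_ B2)]; last by rewrite B2P.
  by exists B1.
have nB1 z : z \notin Bad -> z \notin B1.
  by apply: contraNN => B1z; apply/bigcupP; exists (bd B); rewrite ?cB ?eB1.
have := eq_bd_sep genS x y bB1.
by rewrite (negbTE (nB1 _ nBx)) (negbTE (nB1 _ nBy)) Bx (negbTE By).
Qed.

End GiantCluster.

Lemma leq_cube_expn8 m : m ^ 3 <= 8 ^ m.
Proof.
rewrite (_ : 8 = 2 ^ 3) // -expnM mulnC expnM leq_exp2r //.
by apply: ltnW; apply: ltn_expl.
Qed.

Local Open Scope ring_scope.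

(** * Expected weight of the closed connected cuts *)

Section Percolation.
Variables (R : realType) (gT : finGroupType) (S : {set gT}).
Hypotheses (abG : abelian [set: gT]) (genS : <<S>>%g = [set: gT]).
Hypothesis card_gT : (1 < #|gT|)%N.
Notation E := (gedges (cay_rel S)).
Variables lam alpha : R.
Hypothesis lam0 : 0 < lam.
Hypothesis diam : (gdiam (cay_rel S))%:R <= lam * #|gT|%:R / ln (#|gT|%:R : R).

(* [8 * H ^+ m] dominates both the volume [8 * m ^ 3] enclosed by a connected
   cut of size [m], and [#|gT|] as soon as [m >= ln #|gT| / (6 * lam)]. *)
Notation H := (8 + expR (6 * lam) : R).

Lemma H_gt0 : 0 < H.
Proof. by have := expR_gt0 (6 * lam); lra. Qed.

(** The exponential in [H] forces [6 * lam * m < ln #|gT|]. With the diameter bound,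
    [6 * diam * m < #|gT|], which suffices as the diameter is at least 1. The summand 8 of [H] gives
    the second bound. *)
Lemma small_cut m : 8 * H ^+ m < #|gT|%:R ->
  ((2 * gdiam (cay_rel S)).+1 * (2 * m) < #|gT|)%N /\ (4 * m ^ 2 < #|gT|)%N.
Proof.
move=> small; have e0 := expR_gt0 (6 * lam).
have le8 : (8 ^ m)%:R <= H ^+ m.
  by rewrite natrX lerXn2r ?nnegrE; lra.
have ltn8 : (8 * 8 ^ m < #|gT|)%N.
  by rewrite -(ltr_nat R) natrM; apply: le_lt_trans small; lra.
split; last first.
  apply: leq_ltn_trans ltn8; have := leq_cube_expn8 m.
  by case: (m) => // m' h; rewrite (leq_trans _ (leq_mul (leqnn 8) h)) //; nia.
have lt_exp : expR (6 * lam * m%:R) < #|gT|%:R.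
  apply: le_lt_trans small; rewrite expRM_natr.
  have : expR (6 * lam) ^+ m <= H ^+ m by rewrite lerXn2r ?nnegrE; lra.
  have : 0 <= H ^+ m by rewrite exprn_ge0 // ltW // H_gt0.
  lra.
have n1 : 1 < #|gT|%:R :> R by rewrite ltr1n.
have lt_ln : 6 * lam * m%:R < ln (#|gT|%:R : R).
  by rewrite -ltr_expR lnK // posrE; lra.
have ln0 : 0 < ln (#|gT|%:R : R) by rewrite ln_gt0.
have D0 : 1 <= (gdiam (cay_rel S))%:R :> R by rewrite ler1n gdiam_gt0.
move: diam; rewrite ler_pdivlMr // => leD.
have bound (D M L n : R) : D * L <= lam * n -> 6 * lam * M < L -> 1 <= D ->
    0 <= M -> (2 * D + 1) * (2 * M) < n.
  move=> leDL ltML D1 M0; have h1 : D * (6 * lam * M) < lam * n.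
    by apply: lt_le_trans leDL; rewrite ltr_pM2l //; lra.
  have h2 : 6 * D * M < n by rewrite -(ltr_pM2l lam0); lra.
  by apply: le_lt_trans h2; nra.
rewrite -(ltr_nat R) !natrM -natr1 natrM.
exact: bound leD lt_ln D0 (ler0n _ _).
Qed.

Definition cut_weight (w : {set {set gT}}) : R :=
  \sum_(F : {set {set gT}} | conn_set (close S) F && (F \subset E :\: w))
    8 * H ^+ #|F|.

(** The terms being nonnegative, the bound holds for each closed cut, making it short, as well as
    for the sum, limiting the enclosed volume. *)
Lemma cut_weight_big w : 0 < alpha < 1 ->
  cut_weight w < (1 - alpha) * #|gT|%:R -> big_cluster (cay_rel S) alpha w.
Proof.
move=> /andP[a0 a1] lt_w.
have n0 : 0 < #|gT|%:R :> R by rewrite ltr0n; apply: ltnW.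
have [|x lex] := large_cluster abG genS (w := w).
  move=> F cF sF; apply: small_cut.
  have lt_n : cut_weight w < #|gT|%:R by nra.
  apply: le_lt_trans lt_n; rewrite /cut_weight (bigD1 F) ?cF //= lerDl.
  apply: sumr_ge0 => G _; rewrite mulr_ge0 // exprn_ge0 // ltW //; exact: H_gt0.
apply/existsP; exists x.
move: lex; rewrite -(ler_nat R) natrD => lex.
suff : (\sum_(F : {set {set gT}} | conn_set (close S) F && (F \subset E :\: w))
          8 * #|F| ^ 3)%:R <= cut_weight w by lra.
rewrite natr_sum; apply: ler_sum => F _; rewrite natrM ler_pM2l //.
apply: le_trans (_ : (8 ^ #|F|)%:R <= _); first by rewrite ler_nat leq_cube_expn8.
by rewrite natrX lerXn2r ?nnegrE; have := expR_gt0 (6 * lam); lra.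
Qed.

(** After exchanging sums, [perc_closed] turns the expectation into 8 times the generating function
    of connected cuts at [H * (1 - p)]. Then [sum_conn_set] gives a factor 2, and the number of
    edges is at most [k * #|gT|]. *)
Lemma expect_cut_weight k (p : R) : 0 <= p <= 1 -> (#|cay_gens S| <= k)%N ->
  (2 * k.+1 * k)%:R ^+ 2 * (H * (1 - p)) <= 1 / 2 ->
  \sum_(w in powerset E) p ^+ #|w| * (1 - p) ^+ (#|E| - #|w|) * cut_weight w
    <= 16 * k%:R * H * (1 - p) * #|gT|%:R.
Proof.
move=> /andP[p0 p1] card_A small; have h0 := H_gt0.
have degr e : e \in E -> (#|[set e' in E | close S e e']| <= 2 * k.+1 * k)%N.
  by move=> Ee; apply: leq_trans (card_close Ee) _; rewrite !leq_mul.
have y0 : 0 <= H * (1 - p) by rewrite mulr_ge0; lra.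
have := sum_conn_set (@close_sym gT S) degr y0 small.
have : #|E|%:R <= #|gT|%:R * k%:R :> R.
  rewrite -natrM ler_nat; apply: leq_trans (card_gedges S) _.
  by rewrite leq_mul.
have -> : \sum_(w in powerset E) p ^+ #|w| * (1 - p) ^+ (#|E| - #|w|) * cut_weight w
    = 8 * \sum_(F : {set {set gT}} | (F \subset E) && conn_set (close S) F)
            (H * (1 - p)) ^+ #|F|.
  under eq_bigr do rewrite /cut_weight mulr_sumr.
  rewrite (exchange_big_dep (fun F : {set {set gT}} =>
    (F \subset E) && conn_set (close S) F)) /=.
    rewrite mulr_sumr; apply: eq_bigr => F /andP[sF cF].
    transitivity ((\sum_(w in powerset E | F \subset E :\: w)
        p ^+ #|w| * (1 - p) ^+ (#|E| - #|w|)) * (8 * H ^+ #|F|)).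
      by rewrite mulr_suml; apply: eq_bigl => w; rewrite cF.
    by rewrite (perc_closed p sF) exprMn mulrC mulrA.
  by move=> w F _ /andP[-> sF]; rewrite andbT (subset_trans sF) ?subsetDl.
move: (\sum_(F | _) _) => s leE les.
have : 2 * #|E|%:R * (H * (1 - p)) <= 2 * (#|gT|%:R * k%:R) * (H * (1 - p)).
  by rewrite ler_wpM2r // ler_pM2l.
nra.
Qed.

End Percolation.

(** * Choice of the constant and Markov's inequality *)

Unset Implicit Arguments.

Theorem theorem1p3 (R : realType) (k : nat) (lam alpha q : R) :
  (1 <= k)%N -> 0 < lam -> 0 < alpha < 1 -> 0 < q < 1 ->
  exists eps : R, 0 < eps /\
    forall (gT : finGroupType) (S : {set gT}),
      abelian [set: gT] ->
      <<S>>%g = [set: gT] ->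
      (1 < #|gT|)%N ->
      (forall x : gT, (cay_deg S x <= k)%N) ->
      (gdiam (cay_rel S))%:R <= lam * #|gT|%:R / ln (#|gT|%:R : R) ->
      p_c (cay_rel S) alpha q <= 1 - eps.
Proof.
move=> k1 lam0 a01 q01; have /andP[a0 a1] := a01; have /andP[q0 q1] := q01.
pose H := 8 + expR (6 * lam).
have h0 : 8 < H by have := expR_gt0 (6 * lam); rewrite /H; lra.
pose d : R := (2 * k.+1 * k)%:R ^+ 2.
(* The first summand makes the expected weight at most [(1 - alpha) * (1 - q) * #|gT|]; the second
   keeps the ratio of the geometric series at most 1/2. *)
pose den := 16 * k%:R * H + 2 * d * H.
have k1R : 1 <= k%:R :> R by rewrite ler1n.
have d0 : 0 <= d by apply: exprn_ge0.
have dH0 : 0 <= d * H by rewrite mulr_ge0 //; lra.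
have kH : 8 < k%:R * H by nra.
have den1 : 1 < den by rewrite /den; lra.
pose eps := (1 - alpha) * (1 - q) / den.
have eden : eps * den = (1 - alpha) * (1 - q) by rewrite /eps divfK //; lra.
have eps0 : 0 < eps by rewrite /eps divr_gt0 ?mulr_gt0; lra.
have prod1 : (1 - alpha) * (1 - q) < 1 by nra.
have eps1 : eps <= 1 by nra.
have epsd : d * (H * eps) <= 1 / 2 by rewrite /den in eden; nra.
have epsk : 16 * k%:R * H * eps <= (1 - alpha) * (1 - q) by rewrite /den in eden; nra.
exists eps; split=> // gT S abG genS n1 deg diam.
apply: ge_inf; first by exists 0 => p [/andP[]].
split; first by lra.
set E := gedges (cay_rel S); set p : R := 1 - eps.
have card_A : (#|cay_gens S| <= k)%N by rewrite (card_cay_gens S 1%g).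
have p01 : 0 <= p <= 1 by rewrite /p; lra.
have ep : 1 - p = eps by rewrite /p; ring.
have EX := expect_cut_weight (S := S) (lam := lam) p01 card_A.
rewrite ep in EX; have {}EX := EX epsd.
have n0 : 0 < #|gT|%:R :> R by rewrite ltr0n; apply: ltnW.
pose mu (w : {set {set gT}}) := p ^+ #|w| * eps ^+ (#|E| - #|w|).
have mu0 w : 0 <= mu w by rewrite /mu mulr_ge0 ?exprn_ge0; lra.
have total : \sum_(w in powerset E) mu w = 1.
  by rewrite sum_powerset /p subrK expr1n.
pose big := big_cluster (cay_rel S) alpha.
have split1 : perc_prob (cay_rel S) p big + \sum_(w in powerset E | ~~ big w) mu w = 1.
  by rewrite -total [RHS](bigID big) /= /perc_prob ep.
(* By [cut_weight_big], a configuration without a big cluster has weight at least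
   [(1 - alpha) * #|gT|]. *)
have markov : (1 - alpha) * #|gT|%:R * \sum_(w in powerset E | ~~ big w) mu w
    <= \sum_(w in powerset E) mu w * cut_weight S lam w.
  rewrite mulr_sumr [leRHS](bigID big) /= -[leLHS]add0r lerD //.
    apply: sumr_ge0 => w _; rewrite mulr_ge0 //; apply: sumr_ge0 => F _.
    by rewrite mulr_ge0 // exprn_ge0 // ltW // H_gt0.
  apply: ler_sum => w /andP[_ nbig]; rewrite mulrC ler_wpM2l // leNgt.
  by apply: contraNN nbig; apply: cut_weight_big.
have cancel (a b n s : R) : 0 < a -> 0 < n -> a * n * s <= a * b * n -> s <= b.
  by move=> a_gt0 n_gt0; rewrite mulrAC -!mulrA ler_pM2l // ler_pM2r.
have le_closed : \sum_(w in powerset E | ~~ big w) mu w <= 1 - q.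
  apply: (cancel (1 - alpha) _ #|gT|%:R) => //; first by lra.
  apply: le_trans markov (le_trans EX _).
  by rewrite ler_wpM2r // ltW.
by move: split1 le_closed; rewrite -/big; lra.
Qed.
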